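(* Let ${\boldsymbol a}=(a_i)_{i\ge0}$ be a sequence of non-negative integers with $a_0>0$ which stabilises to a non-zero integer (it is eventually constant with a positive value). Let ${\boldsymbol A}$, ${\boldsymbol x}_{\boldsymbol a}$, $R$ and $g$ be as defined in the context. Then there exist an integer $p\ge0$ and integers $\alpha_i,\beta_i$ such that $$[{\boldsymbol x}_{\boldsymbol a}R({\boldsymbol A}){\boldsymbol A}^n]_0=\begin{cases}\alpha_0C_k+\cdots+\alpha_pC_{k+p}& \text{if } n=2k,\\ \beta_0C_k+\cdots+\beta_pC_{k+p}& \text{if } n=2k+1,\end{cases}$$ where $C_j=\frac{1}{j+1}\binom{2j}{j}$ is the $j$-th Catalan number. Furthermore, if $g(x)=\gamma_0+\gamma_1x+\cdots+\gamma_mx^m$, then $\alpha_i=-\gamma_{2i}$ and $\beta_{i+1}=-\gamma_{2i+1}$ for $i\ge0$, while $\beta_0=0$. Thus, not all $\alpha_i,\beta_i$ are zero.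
   Context: ${\boldsymbol A}=(A_{ij})_{i,j\ge0}$ is the infinite substitution matrix of the substitution $\varrho_{\boldsymbol a}([0])=[0]^{a_0}[1]$, $\varrho_{\boldsymbol a}([i])=[0]^{a_i}[i-1][i+1]$ for $i>0$, on letters $[i]$, $i\in\mathbb{N}_0$: $A_{0,0}=a_0$, $A_{0,1}=a_1+1$, $A_{0,j}=a_j$ for $j\ge2$, $A_{i,i-1}=A_{i,i+1}=1$ for $i\ge1$, and all other entries are $0$. Every column has finitely many non-zero entries, so row vectors can be multiplied on the right by powers of ${\boldsymbol A}$. $[\boldsymbol v]_0$ denotes the initial (index $0$) entry of $\boldsymbol v$. ${\boldsymbol B}$ is the operator $\boldsymbol v\mapsto\boldsymbol v{\boldsymbol A}$ on row vectors. Let $\mu\in(0,1)$ be the unique real number with $\frac1\mu=\sum_{i\ge0}a_i\mu^i$, let $\lambda=\mu+\frac1\mu$ (an algebraic number), and let $Q$ be the minimal polynomial of $\lambda$, scaled to have integer coefficients (e.g. $2x-5$ for $\lambda=5/2$). Define ${\boldsymbol x}_{\boldsymbol a}=(1,1,1,\dots)Q({\boldsymbol A})$. Define ${\boldsymbol e}_0=(-1,a_0,a_1,a_2,\dots)$, ${\boldsymbol e}_1=(1,-1-a_0,a_0-a_1,a_1-a_2,a_2-a_3,\dots)$ (finitely supported since ${\boldsymbol a}$ is eventually constant), and for $i\ge2$ let ${\boldsymbol e}_i$ be ${\boldsymbol e}_1$ shifted to the right by $i-1$ positions, with $i-1$ zeros prepended. Previously established results, which are taken as given, provide: a non-zero polynomial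 $R(x)$ with integer coefficients such that ${\boldsymbol x}_{\boldsymbol a}R({\boldsymbol A})$ is a finite linear combination of the vectors ${\boldsymbol e}_i$, $i\ge0$; and, for this $R$, a non-zero polynomial $g(x)$ with integer coefficients such that ${\boldsymbol x}_{\boldsymbol a}R({\boldsymbol A})=g({\boldsymbol B})({\boldsymbol e}_0)$. $R$ and $g$ denote these polynomials, and coefficients $\gamma_j$ with $j>m$ are read as $0$. *)

(* Defs.v *)
From mathcomp Require Import all_boot all_order all_algebra.
From mathcomp Require Import reals topology normedtype sequences.
Import Order.TTheory GRing.Theory Num.Theory.
Import numFieldNormedType.Exports.

Set Implicit Arguments.
Unset Strict Implicit.
Unset Printing Implicit Defensive.

Local Open Scope ring_scope.
Local Open Scope classical_set_scope.

Definition stabilises (a : nat -> nat) : Prop :=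
  exists N c : nat, (0 < c)%N /\ forall i : nat, (N <= i)%N -> a i = c.

Definition substmx (a : nat -> nat) (i j : nat) : int :=
  if i == 0%N then (a j)%:Z + (j == 1%N)%:Z
  else ((i == j.+1) || (j == i.+1))%:Z.

Lemma substmx_eq0 a i j : (j.+1 < i)%N -> substmx a i j = 0.
Proof.
move=> ji; rewrite /substmx (gtn_eqF (leq_ltn_trans _ ji)) //.
by rewrite (gtn_eqF ji) ltn_eqF // ltnS; exact: ltnW (ltnW ji).
Qed.

(* The row-by-matrix product [v A]; by [substmx_eq0] the entries of column [j]
   vanish from row [j.+2] on, so the sum below is the whole product (see
   [opBE]). *)
Definition opB (a : nat -> nat) (v : nat -> int) (j : nat) : int :=
  \sum_(i < j.+2) v i * substmx a i j.

Lemma opBE a v j n : (j.+2 <= n)%N ->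
  opB a v j = \sum_(i < n) v i * substmx a i j.
Proof.
move=> jn; rewrite /opB.
rewrite -(big_mkord xpredT (fun i => v i * substmx a i j)).
rewrite -[RHS](big_mkord xpredT (fun i => v i * substmx a i j)).
rewrite (@big_cat_nat _ _ _ j.+2 0%N n) //= [X in _ + X]big_nat_cond.
rewrite [X in _ + X]big1 ?addr0 // => i /andP[/andP[ji _] _].
by rewrite substmx_eq0 ?mulr0.
Qed.

(* [v A^n], which is also [B^n v]. *)
Definition rvpow (a : nat -> nat) (v : nat -> int) (n : nat) : nat -> int :=
  iter n (opB a) v.

(* [v P(A)], which is also [P(B)(v)]. *)
Definition rvpoly (a : nat -> nat) (v : nat -> int) (P : {poly int})
    (j : nat) : int :=
  \sum_(i < size P) P`_i * rvpow a v i j.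

Definition is_mu (K : realType) (a : nat -> nat) (mu : K) : Prop :=
  [/\ 0 < mu, mu < 1 &
      series (fun i : nat => (a i)%:R * mu ^+ i) @ \oo --> mu^-1].

Definition is_minpoly (K : realType) (x : K) (M : {poly rat}) : Prop :=
  [/\ M \is monic, root (map_poly ratr M) x &
      forall P : {poly rat}, P != 0 -> root (map_poly ratr P) x ->
        (size M <= size P)%N].

Definition is_int_minpoly (K : realType) (x : K) (Q : {poly int}) : Prop :=
  exists (M : {poly rat}) (c : rat),
    [/\ is_minpoly x M, c != 0 & map_poly (intr : int -> rat) Q = c *: M].

Definition xvec (a : nat -> nat) (Q : {poly int}) : nat -> int :=
  rvpoly a (fun _ : nat => 1) Q.

Definition evec0 (a : nat -> nat) (j : nat) : int :=
  match j with 0%N => - 1 | j'.+1 => (a j')%:Z end.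

Definition evec1 (a : nat -> nat) (j : nat) : int :=
  match j with
  | 0%N => 1
  | 1%N => - 1 - (a 0%N)%:Z
  | j'.+2 => (a j')%:Z - (a j'.+1)%:Z
  end.

Definition evec (a : nat -> nat) (i j : nat) : int :=
  match i with
  | 0%N => evec0 a j
  | i'.+1 => if (j < i')%N then 0 else evec1 a (j - i')%N
  end.

Definition in_span_evec (a : nat -> nat) (v : nat -> int) : Prop :=
  exists (n : nat) (c : nat -> rat),
    forall j : nat, (v j)%:~R = \sum_(i < n) c i * (evec a i j)%:~R.

(* The division is exact, see [catalanE]. *)
Definition catalan (j : nat) : nat := ('C(j.*2, j) %/ j.+1)%N.

Lemma dvdn_catalan j : (j.+1 %| 'C(j.*2, j))%N.
Proof.
have H : (j.+1 * 'C(j.*2, j.+1) = j * 'C(j.*2, j))%N.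
  by rewrite mul_bin_left -addnn addnK.
have jC : (j.+1 %| j * 'C(j.*2, j))%N by rewrite -H dvdn_mulr.
by rewrite -(dvdn_addr _ jC) addnC -mulSn dvdn_mulr.
Qed.

Lemma catalanE j :
  (catalan j)%:R = (j.+1%:R)^-1 * ('C(j.*2, j))%:R :> rat.
Proof.
apply: (mulfI (_ : j.+1%:R != 0)); first by rewrite pnatr_eq0.
by rewrite mulVKf ?pnatr_eq0 // -natrM mulnC divnK ?dvdn_catalan.
Qed.

(* Main.v *)
Require Import Defs.
From mathcomp Require Import all_boot all_order all_algebra.
From mathcomp Require Import reals topology normedtype sequences.
From mathcomp Require Import zify.
Import Order.TTheory GRing.Theory Num.Theory.
Local Open Scope ring_scope.

(** The shifts [f_i] of [e_0] to the right by [i] positions satisfy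
    [f_0 A = f_1] and [f_(i+1) A = f_i + f_(i+2)]: on them, [A] acts as the
    adjacency matrix of the half-line with vertices 0, 1, 2, ...  Since the
    initial entry of [f_i] is -1 for [i = 0] and 0 otherwise, the initial entry
    of [e_0 A^n] is minus the number of closed walks of length [n] from 0 on the
    half-line, which are the Dyck paths: there are [C_k] of them for [n = 2k]
    and none for odd [n] ([rvpow_evec0_0]).  The count comes from the reflection
    principle, as a difference of two numbers of free walks
    ([rvpow_evec0_shift]).

    If [x R(A) = g(B)(e_0)] then, by linearity, [x R(A) A^n] is the sum of the
    [g_i e_0 A^(n+i)] ([rvpow_rvpoly]).  Only the indices [i] with the parity of
    [n] contribute to the initial entry; this is the announced combination of
    Catalan numbers, whose coefficients are the [-g_i].  One of them is non-zero
    because the leading coefficient of [g] is. *)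

(** * Linearity of the action of the matrix *)

Lemma opB0 a v : opB a v 0%N = v 0%N * (a 0%N)%:Z + v 1%N.
Proof.
by rewrite /opB !big_ord_recr big_ord0 /= /substmx /= add0r addr0 mulr1.
Qed.

Lemma opBS a v j :
  opB a v j.+1 = v 0%N * (a j.+1)%:Z + v j + v j.+2.
Proof.
rewrite /opB big_ord_recl big_ord_recr /= /substmx /= eqxx mulr1 addrA.
congr (_ + _).
case: j => [|j].
  by rewrite big_ord_recr big_ord0 /= mulr0 !addr0 mulrDr mulr1.
rewrite !big_ord_recr /= big1 => [|i _]; last first.
  case: i => i /= ij; rewrite /bump /= add1n !eqSS.
  by rewrite ltn_eqF ?gtn_eqF ?mulr0 //; lia.
rewrite /bump /= !add1n !eqxx orbT (_ : _ || _ = false); last by lia.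
by rewrite !addr0 add0r mulr0 addr0 mulr1.
Qed.

Lemma eq_opB a v w : v =1 w -> opB a v =1 opB a w.
Proof. by move=> vw j; apply: eq_bigr => i _; rewrite vw. Qed.

Lemma eq_rvpow a v w n : v =1 w -> rvpow a v n =1 rvpow a w n.
Proof. by move=> vw; elim: n => //= n IHn; apply: eq_opB. Qed.

Lemma rvpowD a v w n j :
  rvpow a (fun i => v i + w i) n j = rvpow a v n j + rvpow a w n j.
Proof.
elim: n j => //= n IHn j; rewrite (eq_opB _ _ _ IHn) /opB -big_split /=.
by apply: eq_bigr => i _; rewrite mulrDl.
Qed.

Lemma rvpow_rvpoly a v (P : {poly int}) n j :
  rvpow a (rvpoly a v P) n j = \sum_(i < size P) P`_i * rvpow a v (n + i) j.
Proof.
elim: n j => //= n IHn j; rewrite (eq_opB _ _ _ IHn) /opB.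
under [LHS]eq_bigr do rewrite mulr_suml.
rewrite exchange_big; apply: eq_bigr => i _ /=.
by rewrite mulr_sumr; apply: eq_bigr => k _; rewrite mulrA.
Qed.

(** * Free walks and the reflection principle *)

(** The number of walks of length [n] on the integers, with steps -1 and 1, from
    0 to [i], or equally from [i] to 0: those from 0 to [i] have [(n + i) / 2]
    steps equal to 1. *)
Definition free_walks (n i : nat) : nat :=
  if odd (n + i) then 0%N else 'C(n, (n + i)./2).

Lemma free_walksSS n i :
  free_walks n.+1 i.+1 = (free_walks n i + free_walks n i.+2)%N.
Proof.
rewrite /free_walks !addnS !addSn /= !negbK.
by case: ifP => // _; rewrite binS addnC.
Qed.

(** The last step of a walk ending at 0 comes from 1 or from -1, and these two
    cases are equinumerous by symmetry. *)
Lemma free_walksS0 n : free_walks n.+1 0 = (2 * free_walks n 1)%N.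
Proof.
rewrite /free_walks addn0 addn1; case: ifP => //= /negbFE on.
rewrite uphalf_half on add1n binS -(odd_double_half n) on add1n.
rewrite -[X in (_ + X)%N]bin_sub; last by rewrite -addnn; lia.
by rewrite /= uphalf_double (_ : (_.+1 - _)%N = (n./2).+1) -?addnn; lia.
Qed.

Lemma catalan_free_walks k :
  (catalan k)%:Z = (free_walks k.*2 0)%:Z - (free_walks k.*2 2)%:Z.
Proof.
rewrite /free_walks addn0 addn2 /= odd_double /= doubleK.
have cat : (catalan k * k.+1 = 'C(k.*2, k))%N by exact/divnK/dvdn_catalan.
have binS : (k.+1 * 'C(k.*2, k.+1) = k * 'C(k.*2, k))%N.
  by rewrite mul_bin_left -addnn addnK.
apply: (mulfI (_ : k.+1%:Z != 0)) => //.
by rewrite mulrBr -!PoszM binS -cat; lia.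
Qed.

(** * The orbit of the initial basis vector *)

Definition evec0_shift (a : nat -> nat) (i j : nat) : int :=
  if (j < i)%N then 0 else evec0 a (j - i)%N.

Lemma opB_evec0_shift0 a : opB a (evec0_shift a 0) =1 evec0_shift a 1.
Proof.
case=> [|[|j]]; rewrite ?opB0 ?opBS /evec0_shift /= ?subn0 ?subn1 /=; lia.
Qed.

Lemma opB_evec0_shiftS a i :
  opB a (evec0_shift a i.+1) =1
  (fun j => evec0_shift a i j + evec0_shift a i.+2 j).
Proof.
have shiftSS k j : evec0_shift a k.+1 j.+1 = evec0_shift a k j.
  by rewrite /evec0_shift ltnS subSS.
have shiftS0 k : evec0_shift a k.+1 0 = 0 by [].
case=> [|j]; first by rewrite opB0 shiftSS !shiftS0 mul0r add0r addr0.
by rewrite opBS !shiftSS shiftS0 mul0r add0r addrC.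
Qed.

(** Up to the sign, the left-hand side counts the walks of length [n] from [i]
    to 0 that stay non-negative.  They are the free ones minus those that visit
    -1; reflecting the latter at -1 up to their first visit there makes them
    start at [-2 - i], hence travel a distance [i + 2].  In the induction,
    symmetry enters only through [free_walksS0]. *)
Lemma rvpow_evec0_shift a n i :
  rvpow a (evec0_shift a i) n 0%N =
  (free_walks n i.+2)%:Z - (free_walks n i)%:Z.
Proof.
have powS v m : rvpow a v m.+1 = rvpow a (opB a v) m by rewrite /rvpow iterSr.
elim: n i => [|n IHn] [|i].
- by [].
- rewrite /rvpow /evec0_shift /= /free_walks !add0n /=.
  by rewrite negbK; case: i => // i; case: ifP.
- rewrite powS (eq_rvpow _ _ _ _ (opB_evec0_shift0 a)) IHn.
  by rewrite free_walksS0 free_walksSS; lia.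
- rewrite powS (eq_rvpow _ _ _ _ (opB_evec0_shiftS a i)) rvpowD !IHn.
  by rewrite !free_walksSS; lia.
Qed.

Lemma rvpow_evec0_0 a n :
  rvpow a (evec0 a) n 0%N = if odd n then 0 else - (catalan n./2)%:Z.
Proof.
have shift0 : evec0 a =1 evec0_shift a 0.
  by move=> j; rewrite /evec0_shift ltn0 subn0.
rewrite (eq_rvpow _ _ _ _ shift0) rvpow_evec0_shift; case: ifPn => on.
  by rewrite /free_walks addn2 addn0 /= negbK on.
by rewrite catalan_free_walks halfK (negbTE on) subn0 opprB.
Qed.

(** * Splitting by parity *)

Lemma sum_coef_parity (P : {poly int}) (F : nat -> int) m :
  (size P <= m.*2)%N ->
  \sum_(i < size P) P`_i * F i =
  \sum_(i < m) (P`_(2 * i) * F (2 * i)%N + P`_(2 * i + 1) * F (2 * i + 1)%N).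
Proof.
move=> Pm; transitivity (\sum_(i < m.*2) P`_i * F i).
  rewrite (big_ord_widen _ (fun i => P`_i * F i) Pm) big_mkcond.
  by apply: eq_bigr => i _; case: ltnP => // Pi; rewrite nth_default ?mul0r.
elim: m {Pm} => [|m IHm]; first by rewrite !big_ord0.
by rewrite doubleS !big_ord_recr /= IHm -addrA addn1 mul2n.
Qed.

Theorem lemma4p7 (K : realType) (a : nat -> nat) (mu : K) (Q R g : {poly int})
  (a0_gt0 : (0 < a 0)%N)
  (a_stab : stabilises a)
  (mu_def : is_mu a mu)
  (Q_def : is_int_minpoly (mu + mu^-1) Q)
  (R_neq0 : R != 0)
  (xR_span : in_span_evec a (rvpoly a (xvec a Q) R))
  (g_neq0 : g != 0)
  (xR_g : forall j : nat,
     rvpoly a (xvec a Q) R j = rvpoly a (evec a 0%N) g j) :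
  exists (p : nat) (alpha beta : nat -> int),
    [/\ (forall i : nat, (p < i)%N -> alpha i = 0 /\ beta i = 0),
        (forall n k : nat,
           (n = 2 * k)%N ->
           rvpow a (rvpoly a (xvec a Q) R) n 0%N =
             \sum_(i < p.+1) alpha i * (catalan (k + i)%N)%:Z),
        (forall n k : nat,
           (n = 2 * k + 1)%N ->
           rvpow a (rvpoly a (xvec a Q) R) n 0%N =
             \sum_(i < p.+1) beta i * (catalan (k + i)%N)%:Z),
        [/\ forall i : nat, alpha i = - g`_(2 * i)%N,
            forall i : nat, beta i.+1 = - g`_(2 * i + 1)%N &
            beta 0%N = 0] &
        exists i : nat, (i <= p)%N /\ (alpha i != 0 \/ beta i != 0)].
Proof.
pose c m : int := if odd m then 0 else - (catalan m./2)%:Z.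
have c_even m : c m.*2 = - (catalan m)%:Z by rewrite /c odd_double doubleK.
have c_odd m : c m.*2.+1 = 0 by rewrite /c /= odd_double.
have entry0 n : rvpow a (rvpoly a (xvec a Q) R) n 0%N =
    \sum_(i < size g) g`_i * c (n + i)%N.
  rewrite (eq_rvpow _ _ _ _ xR_g) rvpow_rvpoly.
  by apply: eq_bigr => i _; rewrite /c -(rvpow_evec0_0 a).
exists (size g), (fun i => - g`_(2 * i)%N),
  (fun i => if i is i'.+1 then - g`_(2 * i' + 1)%N else 0).
split=> //.
- case=> // i gi; have gi1 := ltnW gi.
  by rewrite !nth_default ?oppr0 //; apply: (leq_trans gi1); lia.
- move=> n k ->.
  rewrite entry0 (sum_coef_parity g (fun i => c (2 * k + i)%N) (size g).+1);
    last by lia.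
  apply: eq_bigr => i _.
  rewrite (_ : (2 * k + 2 * i = (k + i).*2)%N); last by lia.
  rewrite (_ : (2 * k + (2 * i + 1) = (k + i).*2.+1)%N); last by lia.
  by rewrite c_even c_odd mulr0 addr0 mulrN mulNr.
- move=> n k ->.
  (* One pair of coefficients fewer than in the even case: [beta_0] is not the
     opposite of a coefficient of [g]. *)
  rewrite entry0 (sum_coef_parity g (fun i => c (2 * k + 1 + i)%N) (size g));
    last by lia.
  rewrite [RHS]big_ord_recl mul0r add0r.
  apply: eq_bigr => i _ /=.
  rewrite (_ : (2 * k + 1 + 2 * i = (k + i).*2.+1)%N); last by lia.
  rewrite (_ : (2 * k + 1 + (2 * i + 1) = (k + i.+1).*2)%N); last by lia.
  by rewrite c_even c_odd mulr0 add0r mulrN mulNr.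
- have g_gt0 : (0 < size g)%N by rewrite size_poly_gt0.
  have lead_neq0 : - g`_(size g).-1 != 0.
    by rewrite oppr_eq0 -/(lead_coef g) lead_coef_eq0.
  have [odd_deg|even_deg] := boolP (odd (size g).-1).
    exists ((size g).-1./2).+1; split; first by lia.
    by right; rewrite (_ : (2 * _ + 1)%N = (size g).-1) //; lia.
  exists ((size g).-1./2); split; first by lia.
  by left; rewrite (_ : (2 * _)%N = (size g).-1) //; lia.
Qed.
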